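(* For a ring $R$ the following are equivalent: (1) $R$ is right almost perfect; (2) $R$ is $h$-local and every non-faithful left $R$-module is semiartinian (equivalently, $R$ satisfies any of the following equivalent conditions: every non-faithful left $R$-module is an essential extension of its socle; every non-zero non-faithful left $R$-module contains a simple submodule; $R/I$ is left semiartinian for every non-zero two-sided ideal $I$; for every proper left ideal $L$ with non-zero core, $R/L$ contains a simple submodule).
   Context: Rings are associative with identity $1\neq 0$. A ring $R$ is called right almost perfect if $R/I$ is a right perfect ring for every two-sided ideal $I$ of $R$ with $I\neq 0$ and $I\neq R$. A ring is semilocal if $R/J(R)$ is semisimple artinian. A ring $R$ is called $h$-local if: (a) for every non-zero proper two-sided ideal $I$ of $R$, the factor ring $R/I$ is semilocal; and (b) every non-zero prime two-sided ideal of $R$ is contained in only one maximal two-sided ideal of $R$. A module is non-faithful if its annihilator in $R$ is non-zero; a module $M$ is semiartinian if every non-zero homomorphic image of $M$ contains a simple submodule; a ring is left semiartinian if every non-zero left module over it has a simple submodule; the core of a left ideal $L$ is the largest two-sided ideal contained in $L$. *)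

(* Defs.v *)
From HB Require Import structures.
From mathcomp Require Import all_boot all_order all_algebra.
Set Implicit Arguments.
Unset Strict Implicit.
Unset Printing Implicit Defensive.
Import GRing.Theory.
Local Open Scope ring_scope.

(* Left modules over a ring R are the MathComp [lmodType R];           *)
(* right R-modules are left modules over the converse ring [R^c].      *)
Definition subp (T : Type) (A B : T -> Prop) : Prop := forall x, A x -> B x.

Definition surjective (A B : Type) (f : A -> B) : Prop :=
  forall y : B, exists x : A, f x = y.

Section Modules.
Variable R : nzRingType.

Definition submodule (M : lmodType R) (S : (M -> Prop)) : Prop :=
  S 0 /\ (forall (a : R) (u v : M), S u -> S v -> S (a *: u + v)).

Definition nonzero_module (M : lmodType R) : Prop := exists x : M, x != 0.

Definition simple_submodule (M : lmodType R) (S : (M -> Prop)) : Prop :=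
  [/\ submodule S, (exists2 x, S x & x != 0) &
      forall T : (M -> Prop), submodule T -> subp T S ->
        (forall x, T x -> x = 0) \/ subp S T].

Definition has_simple_submodule (M : lmodType R) : Prop :=
  exists S : (M -> Prop), simple_submodule S.

Definition non_faithful (M : lmodType R) : Prop :=
  exists2 r : R, r != 0 & forall m : M, r *: m = 0.

Definition semiartinian (M : lmodType R) : Prop :=
  forall (N : lmodType R) (f : {linear M -> N}),
    surjective f -> nonzero_module N -> has_simple_submodule N.

Definition socle (M : lmodType R) : (M -> Prop) :=
  fun x => exists s : seq M,
    (forall y, y \in s -> exists2 S : (M -> Prop), simple_submodule S & S y)
    /\ x = \sum_(y <- s) y.

Definition essential_in (M : lmodType R) (S : (M -> Prop)) : Prop :=
  forall T : (M -> Prop), submodule T -> (exists2 x, T x & x != 0) ->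
    exists x, [/\ T x, S x & x != 0].

Definition projective (P : lmodType R) : Prop :=
  forall (M N : lmodType R) (g : {linear M -> N}) (f : {linear P -> N}),
    surjective g -> exists h : {linear P -> M}, forall x, g (h x) = f x.

Definition superfluous (M : lmodType R) (K : (M -> Prop)) : Prop :=
  forall L : (M -> Prop), submodule L ->
    (forall x : M, exists k l, [/\ K k, L l & x = k + l]) ->
    forall x : M, L x.

Definition has_projective_cover (M : lmodType R) : Prop :=
  exists (P : lmodType R) (p : {linear P -> M}),
    [/\ projective P, surjective p & superfluous (fun x => p x = 0)].

End Modules.

Section Rings.
Variable R : nzRingType.

Definition left_ideal (L : (R -> Prop)) : Prop :=
  [/\ L 0, (forall x y, L x -> L y -> L (x + y)) &
      forall r x, L x -> L (r * x)].

Definition two_sided_ideal (I : (R -> Prop)) : Prop :=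
  [/\ I 0, (forall x y, I x -> I y -> I (x + y)),
      (forall r x, I x -> I (r * x)) &
      (forall r x, I x -> I (x * r))].

Definition nonzero_pred (I : (R -> Prop)) : Prop := exists2 x, I x & x != 0.
Definition proper_pred (I : (R -> Prop)) : Prop := exists x, ~ I x.

Definition maximal_left_ideal (L : (R -> Prop)) : Prop :=
  [/\ left_ideal L, proper_pred L &
      forall L' : (R -> Prop), left_ideal L' -> subp L L' ->
        proper_pred L' -> subp L' L].

Definition maximal_ideal (I : (R -> Prop)) : Prop :=
  [/\ two_sided_ideal I, proper_pred I &
      forall I' : (R -> Prop), two_sided_ideal I' -> subp I I' ->
        proper_pred I' -> subp I' I].

Definition prime_ideal (P : (R -> Prop)) : Prop :=
  [/\ two_sided_ideal P, proper_pred P &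
      forall a b, (forall r, P (a * r * b)) -> P a \/ P b].

Definition jacobson : (R -> Prop) :=
  fun x => forall L : (R -> Prop), maximal_left_ideal L -> L x.

Definition nonzero_core (L : (R -> Prop)) : Prop :=
  exists I : (R -> Prop), [/\ two_sided_ideal I, nonzero_pred I & subp I L].

Definition is_factor_ring (S : nzRingType) (f : {rmorphism R -> S})
  (I : (R -> Prop)) : Prop :=
  surjective f /\ (forall x, f x = 0 <-> I x).

Definition is_factor_module (N : lmodType R) (f : {linear R^o -> N})
  (L : (R -> Prop)) : Prop :=
  surjective f /\ (forall x : R, f x = 0 <-> L x).

Definition semisimple_artinian : Prop :=
  forall L : (R -> Prop), left_ideal L ->
    exists L' : (R -> Prop), [/\ left_ideal L',
      (forall x, L x -> L' x -> x = 0) &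
      (forall x, exists a b, [/\ L a, L' b & x = a + b])].

Definition left_semiartinian_ring : Prop :=
  forall M : lmodType R, nonzero_module M -> has_simple_submodule M.

Definition right_perfect : Prop :=
  forall M : lmodType R^c, has_projective_cover M.

End Rings.

Definition semilocal (R : nzRingType) : Prop :=
  forall (S : nzRingType) (f : {rmorphism R -> S}),
    is_factor_ring f (jacobson (R:=R)) -> semisimple_artinian S.

Definition right_almost_perfect (R : nzRingType) : Prop :=
  forall I : (R -> Prop), two_sided_ideal I -> nonzero_pred I -> proper_pred I ->
    forall (S : nzRingType) (f : {rmorphism R -> S}),
      is_factor_ring f I -> right_perfect S.

Definition h_local (R : nzRingType) : Prop :=
  (forall I : (R -> Prop), two_sided_ideal I -> nonzero_pred I -> proper_pred I ->
    forall (S : nzRingType) (f : {rmorphism R -> S}),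
      is_factor_ring f I -> semilocal S)
  /\
  (forall P : (R -> Prop), prime_ideal P -> nonzero_pred P ->
    forall M1 M2 : (R -> Prop), maximal_ideal M1 -> maximal_ideal M2 ->
      subp P M1 -> subp P M2 -> (forall x, M1 x <-> M2 x)).

(* Main.v *)
(* Right perfect means "semilocal with right T-nilpotent Jacobson radical J"
   (Bass).  If every right module has a projective cover, the covers of the
   cyclic modules give complements modulo J, and the cover of F/FJ, F free of
   countable rank, shows that FJ is superfluous in F, which is T-nilpotence;
   conversely T-nilpotence yields Nakayama's lemma for all modules and the lifting
   of idempotents, so a direct sum of modules eS covers any given module.
   A semilocal ring has T-nilpotent J exactly when it is left semiartinian: a left
   ideal L maximal among those missing all the products j_n...j_1 would have
   no simple submodule in S/L, while T-nilpotence gives in each nonzero left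
   module a nonzero element killed by J.  Finally J is zero in a prime right
   perfect ring, which is therefore simple, so the second half of h-locality is
   automatic. *)
Require Import Defs.
From HB Require Import structures.
From mathcomp Require Import all_boot all_order all_algebra.
From mathcomp Require Import generic_quotient ring_quotient.
From mathcomp Require Import boolp classical_sets.
From mathcomp Require Import freeg ring.
Set Implicit Arguments.
Unset Strict Implicit.
Unset Printing Implicit Defensive.
Import GRing.Theory.
Local Open Scope ring_scope.

(** * Submodules, factor modules and factor rings *)

Definition mk_linear (R : nzRingType) (U V : lmodType R) (f : U -> V)
    (lf : linear f) : {linear U -> V} :=
  HB.pack f (GRing.isLinear.Build R U V *:%R f lf).

Section Submodules.
Variables (R : nzRingType) (M : lmodType R) (K : M -> Prop).
Hypothesis subK : submodule K.

Lemma submod0 : K 0. Proof. by case: subK. Qed.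

Lemma submodD x y : K x -> K y -> K (x + y).
Proof. by move=> Kx Ky; rewrite -[x]scale1r; apply: subK.2. Qed.

Lemma submodZ a x : K x -> K (a *: x).
Proof. by move=> Kx; rewrite -[_ *: _]addr0; apply: subK.2 => //; exact: submod0. Qed.

Lemma submodN x : K x -> K (- x).
Proof. by rewrite -scaleN1r; exact: submodZ. Qed.

Lemma submodB x y : K x -> K y -> K (x - y).
Proof. by move=> Kx /submodN; exact: submodD. Qed.

Lemma submod_sum (I : eqType) (s : seq I) (F : I -> M) :
  (forall i, i \in s -> K (F i)) -> K (\sum_(i <- s) F i).
Proof.
move=> KF; rewrite big_seq; apply: big_ind => //; [exact: submod0|exact: submodD].
Qed.

(** Classical truth values turn the [Prop]-valued submodule into a collective predicate, as subtypes
    and quotients require. *)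
Definition submod_pred : {pred M} := fun x => `[< K x >].

Lemma submod_predP x : reflect (K x) (x \in submod_pred).
Proof. exact: asboolP. Qed.

Fact submod_zmod_closed : zmod_closed submod_pred.
Proof.
split=> [|x y /submod_predP Kx /submod_predP Ky]; apply/submod_predP.
  exact: submod0.
exact: submodB.
Qed.

Definition submod_zmodClosed : zmodClosed M :=
  HB.pack submod_pred (GRing.isZmodClosed.Build M submod_pred submod_zmod_closed).

Fact submod_submod_closed : submod_closed submod_pred.
Proof.
split=> [|a x y /submod_predP Kx /submod_predP Ky]; apply/submod_predP.
  exact: submod0.
exact: subK.2.
Qed.

Definition submod_submodClosed : submodClosed M :=
  HB.pack submod_pred (GRing.isSubmodClosed.Build R M submod_pred submod_submod_closed).

Definition submod_type := {x : M | x \in submod_submodClosed}.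
HB.instance Definition _ := [isSub of submod_type for @sval _ _].
HB.instance Definition _ := [Choice of submod_type by <:].
HB.instance Definition _ := [SubChoice_isSubLmodule of submod_type by <:].

Lemma submodule_typeP : exists (N : lmodType R) (i : {linear N -> M}),
  injective i /\ (forall x, K x <-> exists y, i y = x).
Proof.
exists submod_type, (val : {linear submod_type -> M}); split; first exact: val_inj.
move=> x; split=> [/submod_predP Kx|[y <-]]; first by exists (Sub x Kx : submod_type).
exact/submod_predP/(valP y).
Qed.

Definition mquot := Quotient.quot submod_zmodClosed.
HB.instance Definition _ := GRing.Zmodule.on mquot.

Local Open Scope quotient_scope.

Definition mpi (x : M) : mquot := \pi_(Quotient.quot submod_zmodClosed) x.

Lemma mpiP x y : mpi x = mpi y <-> K (x - y).
Proof.
split=> [/eqP|/submod_predP Kxy]; last apply/eqP; rewrite -Quotient.idealrBE //.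
exact/submod_predP.
Qed.

Lemma mpi_surj : surjective mpi.
Proof. by move=> y; exists (repr y); rewrite /mpi reprK. Qed.

Lemma mpiD x y : mpi (x + y) = mpi x + mpi y.
Proof. by rewrite /mpi !piE. Qed.

Definition mquot_scale (a : R) (q : mquot) : mquot := mpi (a *: repr q).

Lemma mquot_scaleE a x : mquot_scale a (mpi x) = mpi (a *: x).
Proof.
apply/mpiP; rewrite -scalerBr; apply: submodZ; apply/mpiP.
by rewrite /mpi reprK.
Qed.

Fact mquot_scaleA a b q : mquot_scale a (mquot_scale b q) = mquot_scale (a * b) q.
Proof. by have [x <-] := mpi_surj q; rewrite !mquot_scaleE scalerA. Qed.

Fact mquot_scale1 : left_id 1 mquot_scale.
Proof. by move=> q; have [x <-] := mpi_surj q; rewrite mquot_scaleE scale1r. Qed.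

Fact mquot_scaleDr : right_distributive mquot_scale +%R.
Proof.
move=> a q r; have [x <-] := mpi_surj q; have [y <-] := mpi_surj r.
by rewrite -mpiD !mquot_scaleE scalerDr mpiD.
Qed.

Fact mquot_scaleDl q : {morph mquot_scale^~ q : a b / a + b}.
Proof.
by move=> a b; have [x <-] := mpi_surj q; rewrite !mquot_scaleE scalerDl mpiD.
Qed.

HB.instance Definition _ := GRing.Zmodule_isLmodule.Build R mquot
  mquot_scaleA mquot_scale1 mquot_scaleDr mquot_scaleDl.

Lemma quotient_moduleP : exists (N : lmodType R) (f : {linear M -> N}),
  surjective f /\ (forall x, f x = 0 <-> K x).
Proof.
have lin_mpi : linear mpi.
  by move=> a x y; rewrite mpiD -mquot_scaleE.
exists mquot, (mk_linear lin_mpi); split; first exact: mpi_surj.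
move=> x; have -> : mk_linear lin_mpi x = mpi x by [].
have -> : (0 : mquot) = mpi 0 by rewrite /mpi !piE.
by rewrite mpiP subr0.
Qed.

End Submodules.

Section QuotientRing.
Variables (R : nzRingType) (I : R -> Prop).
Hypothesis idI : two_sided_ideal I.
Hypothesis properI : proper_pred I.

Lemma ideal_submodule : submodule (I : R^o -> Prop).
Proof. by case: idI => I0 ID Il _; split=> // a x y Ix Iy; apply: ID => //; exact: Il. Qed.

Lemma proper_ideal1 : ~ I 1.
Proof.
move=> I1; case: properI => x; case: idI => _ _ Il _ [].
by rewrite -[x]mulr1; exact: Il.
Qed.

Definition rquot := mquot ideal_submodule.
HB.instance Definition _ := GRing.Zmodule.on rquot.

Definition rpi : R -> rquot := mpi ideal_submodule.

Lemma rpi_surj : surjective rpi. Proof. exact: mpi_surj. Qed.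

Lemma rpiP x y : rpi x = rpi y <-> I (x - y). Proof. exact: mpiP. Qed.

Local Open Scope quotient_scope.

Definition rquot_mul (p q : rquot) : rquot :=
  rpi (repr (p : Quotient.quot (submod_zmodClosed ideal_submodule))
     * repr (q : Quotient.quot (submod_zmodClosed ideal_submodule))).

Lemma rquot_mulE x y : rquot_mul (rpi x) (rpi y) = rpi (x * y).
Proof.
apply/rpiP; case: idI => _ ID Il Ir.
have I_repr z : I (repr (rpi z : Quotient.quot (submod_zmodClosed ideal_submodule)) - z).
  by apply/rpiP; rewrite /rpi /mpi reprK.
set x' := repr _; set y' := repr _.
have -> : x' * y' - x * y = x' * (y' - y) + (x' - x) * y.
  by rewrite mulrBr mulrBl addrA subrK.
by apply: ID; [apply: Il|apply: Ir]; exact: I_repr.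
Qed.

Fact rquot_mulA : associative rquot_mul.
Proof.
move=> p q r; have [x <-] := rpi_surj p; have [y <-] := rpi_surj q.
by have [z <-] := rpi_surj r; rewrite !rquot_mulE mulrA.
Qed.

Fact rquot_mul1l : left_id (rpi 1) rquot_mul.
Proof. by move=> p; have [x <-] := rpi_surj p; rewrite rquot_mulE mul1r. Qed.

Fact rquot_mul1r : right_id (rpi 1) rquot_mul.
Proof. by move=> p; have [x <-] := rpi_surj p; rewrite rquot_mulE mulr1. Qed.

Lemma rpiD x y : rpi (x + y) = rpi x + rpi y. Proof. exact: mpiD. Qed.

Fact rquot_mulDl : left_distributive rquot_mul +%R.
Proof.
move=> p q r; have [x <-] := rpi_surj p; have [y <-] := rpi_surj q.
by have [z <-] := rpi_surj r; rewrite -rpiD !rquot_mulE mulrDl rpiD.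
Qed.

Fact rquot_mulDr : right_distributive rquot_mul +%R.
Proof.
move=> p q r; have [x <-] := rpi_surj p; have [y <-] := rpi_surj q.
by have [z <-] := rpi_surj r; rewrite -rpiD !rquot_mulE mulrDr rpiD.
Qed.

Lemma rpi0 : rpi 0 = 0. Proof. by rewrite /rpi /mpi !piE. Qed.

Fact rquot_1_neq0 : rpi 1 != 0.
Proof. by apply/eqP; rewrite -rpi0 rpiP subr0; exact: proper_ideal1. Qed.

HB.instance Definition _ := GRing.Zmodule_isNzRing.Build rquot
  rquot_mulA rquot_mul1l rquot_mul1r rquot_mulDl rquot_mulDr rquot_1_neq0.

Fact rpi_zmod : zmod_morphism rpi.
Proof.
move=> x y; apply: (addIr (rpi y)); rewrite subrK -rpiD subrK //.
Qed.

Fact rpi_monoid : monoid_morphism rpi.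
Proof. by split=> // x y; rewrite -rquot_mulE. Qed.

HB.instance Definition _ := GRing.isZmodMorphism.Build R rquot rpi rpi_zmod.
HB.instance Definition _ := GRing.isMonoidMorphism.Build R rquot rpi rpi_monoid.

Lemma factor_ringP : exists (S : nzRingType) (f : {rmorphism R -> S}),
  is_factor_ring f I.
Proof.
exists rquot, (rpi : {rmorphism R -> rquot}); split; first exact: rpi_surj.
by move=> x; rewrite -rpi0 rpiP subr0.
Qed.

End QuotientRing.

(** * Change of scalars *)

Section ChangeOfScalars.
Variables (R S : nzRingType) (f : {rmorphism R -> S}).

Section Restriction.
Variable N : lmodType S.

Definition restr : Type := N.
HB.instance Definition _ := GRing.Zmodule.on restr.

Definition restr_scale (a : R) (x : restr) : restr := f a *: (x : N).

Fact restr_scaleA a b x : restr_scale a (restr_scale b x) = restr_scale (a * b) x.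
Proof. by rewrite /restr_scale scalerA rmorphM. Qed.

Fact restr_scale1 : left_id 1 restr_scale.
Proof. by move=> x; rewrite /restr_scale rmorph1 scale1r. Qed.

Fact restr_scaleDr : right_distributive restr_scale +%R.
Proof. by move=> a x y; rewrite /restr_scale scalerDr. Qed.

Fact restr_scaleDl x : {morph restr_scale^~ x : a b / a + b}.
Proof. by move=> a b; rewrite /restr_scale rmorphD scalerDl. Qed.

HB.instance Definition _ := GRing.Zmodule_isLmodule.Build R restr
  restr_scaleA restr_scale1 restr_scaleDr restr_scaleDl.

Lemma restriction_of_scalarsP : exists (M : lmodType R) (i : M -> N),
  [/\ bijective i, {morph i : x y / x + y} & forall a x, i (a *: x) = f a *: i x].
Proof. by exists restr, idfun; split=> //; exists idfun. Qed.

End Restriction.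

Section Extension.
Variable M : lmodType R.
Hypothesis f_surj : surjective f.
Hypothesis ker_f : forall a, f a = 0 -> forall x : M, a *: x = 0.

Definition extn : Type := M.
HB.instance Definition _ := GRing.Zmodule.on extn.

(** [s] acts through a chosen preimage in [R]; the choice is immaterial because the kernel of [f]
    annihilates [M]. *)
Definition extn_scale (s : S) (x : extn) : extn := projT1 (cid (f_surj s)) *: (x : M).

Lemma extn_scaleE a x : extn_scale (f a) x = a *: (x : M).
Proof.
rewrite /extn_scale; case: cid => b /= fb; apply/eqP; rewrite -subr_eq0 -scalerBl.
by rewrite ker_f // rmorphB fb subrr.
Qed.

Fact extn_scaleA s t x : extn_scale s (extn_scale t x) = extn_scale (s * t) x.
Proof.
have [a <-] := f_surj s; have [b <-] := f_surj t.
by rewrite -rmorphM !extn_scaleE scalerA.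
Qed.

Fact extn_scale1 : left_id 1 extn_scale.
Proof. by move=> x; rewrite -(rmorph1 f) extn_scaleE scale1r. Qed.

Fact extn_scaleDr : right_distributive extn_scale +%R.
Proof. by move=> s x y; rewrite /extn_scale scalerDr. Qed.

Fact extn_scaleDl x : {morph extn_scale^~ x : s t / s + t}.
Proof.
move=> s t; have [a <-] := f_surj s; have [b <-] := f_surj t.
by rewrite -rmorphD !extn_scaleE scalerDl.
Qed.

HB.instance Definition _ := GRing.Zmodule_isLmodule.Build S extn
  extn_scaleA extn_scale1 extn_scaleDr extn_scaleDl.

Lemma extension_of_scalarsP : exists (N : lmodType S) (i : M -> N),
  [/\ bijective i, {morph i : x y / x + y} & forall a x, i (a *: x) = f a *: i x].
Proof.
exists extn, idfun; split=> //; first by exists idfun.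
by move=> a x; rewrite -extn_scaleE.
Qed.

End Extension.

Section SimpleTransfer.
Variables (M : lmodType R) (N : lmodType S) (i : M -> N).
Hypothesis f_surj : surjective f.
Hypothesis i_inj : injective i.
Hypothesis iD : {morph i : x y / x + y}.
Hypothesis iZ : forall a x, i (a *: x) = f a *: i x.

Lemma semilin0 : i 0 = 0.
Proof. by apply: (addrI (i 0)); rewrite -iD !addr0. Qed.

Lemma semilin_image (V : M -> Prop) : submodule V ->
  submodule (fun y => exists2 x, V x & i x = y).
Proof.
move=> subV; split=> [|s _ _ [x Vx <-] [y Vy <-]].
  by exists 0; [exact: submod0|exact: semilin0].
have [a <-] := f_surj s; exists (a *: x + y); last by rewrite iD iZ.
exact: subV.2.
Qed.

Lemma semilin_preimage (V : N -> Prop) : submodule V -> submodule (fun x => V (i x)).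
Proof.
move=> subV; split=> [|a x y Vx Vy]; first by rewrite semilin0; exact: submod0.
by rewrite iD iZ; exact: subV.2.
Qed.

Lemma simple_submodule_image : has_simple_submodule M -> has_simple_submodule N.
Proof.
move=> [V [subV [x Vx x0] minV]]; exists (fun y => exists2 x, V x & i x = y).
split; first exact: semilin_image.
  by exists (i x); [exists x|apply: contra_neq x0 => ix; apply: i_inj; rewrite ix semilin0].
move=> T subT TV; have [|T0|VT] := minV _ (semilin_preimage subT).
- by move=> y /TV[z Vz /i_inj <-].
- by left=> y Ty; have [z Vz zy] := TV y Ty; rewrite -zy (T0 z) ?semilin0 // zy.
- by right=> _ [z /VT Tz <-].
Qed.

Lemma simple_submodule_preimage : surjective i ->
  has_simple_submodule N -> has_simple_submodule M.
Proof.
move=> i_surj [V [subV [y Vy y0] minV]]; exists (fun x => V (i x)).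
split; first exact: semilin_preimage.
  have [x ix] := i_surj y; exists x; first by rewrite ix.
  by apply: contra_neq y0 => x0; rewrite -ix x0 semilin0.
move=> T subT TV; have [|T0|VT] := minV _ (semilin_image subT).
- by move=> _ [x /TV Vx <-].
- by left=> x Tx; apply: i_inj; rewrite semilin0; apply: T0; exists x.
- by right=> x /VT[z Tz /i_inj <-].
Qed.

End SimpleTransfer.
End ChangeOfScalars.

Lemma simple_submodule_inj (R : nzRingType) (M N : lmodType R) (i : {linear M -> N}) :
  injective i -> has_simple_submodule M -> has_simple_submodule N.
Proof.
move=> i_inj; apply: (@simple_submodule_image R R idfun _ _ i) => //.
- by move=> x; exists x.
- by move=> x y; rewrite linearD.
- by move=> a x; rewrite linearZ.
Qed.

(** * Equivalent forms of the semiartinian condition *)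

Lemma nonfaithful_semiartinian_simpleE (R : nzRingType) :
  (forall M : lmodType R, non_faithful M -> semiartinian M) <->
  (forall M : lmodType R, nonzero_module M -> non_faithful M -> has_simple_submodule M).
Proof.
split=> [C0 M M0 nfM|C2 M [r r0 rM] N f f_surj N0].
  apply: (C0 M nfM M idfun) => //.
  by move=> x; exists x.
apply: C2 => //; exists r => // y; have [x <-] := f_surj y.
by rewrite -linearZZ rM linear0.
Qed.

(** A submodule of a non-faithful module is itself a non-faithful module, and its simple submodules
    lie in the socle. Conversely, essentiality is tested on the whole of [M]. *)
Lemma nonfaithful_simple_socleE (R : nzRingType) :
  (forall M : lmodType R, nonzero_module M -> non_faithful M -> has_simple_submodule M) <->
  (forall M : lmodType R, non_faithful M -> essential_in (socle (M:=M))).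
Proof.
split=> [C2 M [r r0 rM] T subT [x Tx x0]|C1 M [x x0] nfM].
  have [N [i [i_inj iP]]] := submodule_typeP subT.
  have [y iy] := (iP x).1 Tx.
  have [||V [subV [z Vz z0] minV]] := C2 N.
  - by exists y; apply: contra_neq x0 => y0; rewrite -iy y0 linear0.
  - by exists r => // m; apply: i_inj; rewrite linearZZ rM linear0.
  have iD : {morph i : x y / x + y} by move=> u v; rewrite linearD.
  have iZ a u : i (a *: u) = idfun a *: i u by rewrite linearZ.
  have simpleV : simple_submodule (fun y => exists2 x, V x & i x = y).
    split.
    - by apply: (semilin_image (f := idfun) _ iD iZ) => // u; exists u.
    - by exists (i z); [exists z|apply: contra_neq z0 => iz; apply: i_inj; rewrite iz linear0].
    move=> W subW WV; have [|W0|VW] := minV _ (semilin_preimage iD iZ subW).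
    - by move=> u /WV[v Vv /i_inj <-].
    - by left=> u Wu; have [v Vv vu] := WV u Wu; rewrite -vu (W0 v) ?linear0 // vu.
    - by right=> _ [u /VW Wu <-].
  exists (i z); split; first by apply/iP; exists z.
    exists [:: i z]; split; last by rewrite big_seq1.
    by move=> u; rewrite inE => /eqP->; eexists; [exact: simpleV|exists z].
  by apply: contra_neq z0 => iz; apply: i_inj; rewrite iz linear0.
have [||y [_ [s [simple_s ys]] y0]] := C1 M nfM (fun=> True); first by [].
  by exists x.
case: s => [|z s] in simple_s ys; first by rewrite ys big_nil eqxx in y0.
by have [|V simpleV _] := simple_s z; [rewrite inE eqxx|exists V].
Qed.

Definition annihilator (R : nzRingType) (M : lmodType R) : R -> Prop :=
  fun r => forall x : M, r *: x = 0.

Lemma annihilator_ideal (R : nzRingType) (M : lmodType R) :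
  two_sided_ideal (annihilator M).
Proof.
split=> [x|a b Ma Mb x|a b Mb x|a b Mb x]; first exact: scale0r.
- by rewrite scalerDl Ma Mb addr0.
- by rewrite -scalerA Mb scaler0.
- by rewrite -scalerA Mb.
Qed.

(** Modules over [R / I] are the [R]-modules killed by [I]; a non-faithful [M] is a module over [R]
    modulo its annihilator. *)
Lemma nonfaithful_simple_factor_ringE (R : nzRingType) :
  (forall M : lmodType R, nonzero_module M -> non_faithful M -> has_simple_submodule M) <->
  (forall I : R -> Prop, two_sided_ideal I -> nonzero_pred I ->
     forall (S : nzRingType) (f : {rmorphism R -> S}),
     is_factor_ring f I -> left_semiartinian_ring S).
Proof.
split=> [C2 I idI [r Ir r0] S f [f_surj kerf] N [x x0]|C3 M [x x0] [r r0 rM]].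
  have [M [i [[j ij ji] iD iZ]]] := restriction_of_scalarsP f N.
  have i0 := semilin0 iD.
  apply: (simple_submodule_image f_surj (can_inj ij) iD iZ); apply: C2.
    by exists (j x); apply: contra_neq x0 => jx; rewrite -(ji x) jx.
  by exists r => // m; apply: (can_inj ij); rewrite iZ (kerf r).2 // scale0r.
have idM := annihilator_ideal M.
have prM : proper_pred (annihilator M).
  by exists 1 => /(_ x); rewrite scale1r; apply/eqP.
have [S [f facf]] := factor_ringP idM prM; have [f_surj kerf] := facf.
have [|N [i [[j ij ji] iD iZ]]] := @extension_of_scalarsP _ _ f M f_surj.
  by move=> a /kerf.
apply: (simple_submodule_preimage f_surj (can_inj ij) iD iZ).
  by move=> y; exists (j y).
apply: (C3 _ idM _ _ _ facf); first by exists r.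
by exists (i x); apply: contra_neq x0 => ix; apply: (can_inj ij); rewrite ix (semilin0 iD).
Qed.

(** [R / L] is killed by every two-sided ideal inside [L]. Conversely, [R x] is [R] modulo the
    annihilator of [x], which contains that of [M]. *)
Lemma nonfaithful_simple_cyclicE (R : nzRingType) :
  (forall M : lmodType R, nonzero_module M -> non_faithful M -> has_simple_submodule M) <->
  (forall L : R -> Prop, left_ideal L -> proper_pred L -> nonzero_core L ->
     forall (N : lmodType R) (f : {linear R^o -> N}),
     is_factor_module f L -> has_simple_submodule N).
Proof.
split=> [C2 L idL [x Lx] [I [idI [r Ir r0] IL]] N f [f_surj kerf]|C4 M [x x0] [r r0 rM]].
  apply: C2; first by exists (f x); apply/eqP => /kerf.
  exists r => // m; have [y <-] := f_surj m; rewrite -linearZZ; apply/kerf/IL.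
  by case: idI => _ _ _; apply.
have subRx : submodule (fun y : M => exists a : R, y = a *: x).
  split=> [|a _ _ [b ->] [c ->]]; first by exists 0; rewrite scale0r.
  by exists (a * b + c); rewrite scalerDl scalerA.
have [N [i [i_inj iP]]] := submodule_typeP subRx.
apply: (simple_submodule_inj i_inj).
have lift a : exists y, i y = a *: x by apply/iP; exists a.
pose g (a : R^o) : N := projT1 (cid (lift a)).
have ig a : i (g a) = a *: x by rewrite /g; case: cid.
have lin_g : linear g.
  by move=> a b c; apply: i_inj; rewrite linearP !ig scalerDl scalerA.
pose L (a : R) := a *: x = 0.
apply: (C4 L _ _ _ N (mk_linear lin_g)).
- split=> [|a b|a b]; rewrite /L; first exact: scale0r.
    by rewrite scalerDl => -> ->; rewrite addr0.
  by rewrite -scalerA => ->; rewrite scaler0.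
- by exists 1; rewrite /L scale1r; apply/eqP.
- exists (annihilator M); split; first exact: annihilator_ideal.
    by exists r.
  by move=> a; apply.
- split=> [y|a].
    have [a ya] := (iP (i y)).2 (ex_intro _ y erefl).
    by exists a; apply: i_inj; rewrite ig.
  have -> : mk_linear lin_g a = g a by [].
  rewrite /L -ig; split=> [->|]; first exact: linear0.
  by move=> iga; apply: i_inj; rewrite iga linear0.
Qed.

(** * The Jacobson radical and semilocal rings *)

(** [Zorn_bigcup] is applied to the sets [X] whose union with [A0] satisfies [P]; the empty chain
    then corresponds to [A0] itself. *)
Lemma zorn_above (T : Type) (P : (T -> Prop) -> Prop) (A0 : T -> Prop) :
  P A0 ->
  (forall F : (T -> Prop) -> Prop, (exists A, F A) -> (forall A, F A -> P A) ->
     (forall A B, F A -> F B -> subp A B \/ subp B A) ->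
     P (fun x => exists2 A, F A & A x)) ->
  exists A, [/\ P A, subp A0 A & forall B, P B -> subp A B -> subp B A].
Proof.
move=> P0 Pchain.
have Pext X Y : (forall x, X x <-> Y x) -> P X -> P Y.
  by move=> XY; have -> : X = Y by apply: funext => x; apply: propext.
pose Q (X : set T) := P (fun x => A0 x \/ X x).
have [|A [QA maxA]] := @Zorn_bigcup T Q.
  move=> F FQ Ftot; rewrite /Q.
  have [F0|/existsNP[A /contrapT FA]] := pselect (forall A, ~ F A).
    by apply: Pext P0 => x; split=> [|[//|[A /F0[]]]]; left.
  pose G Y := exists2 X, F X & Y = (fun x => A0 x \/ X x).
  apply: (Pext (fun x => exists2 Y, G Y & Y x)); last first.
    apply: Pchain; first by exists (fun x => A0 x \/ A x), A.
      by move=> _ [X /FQ + ->].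
    move=> _ _ [X FX ->] [Y FY ->]; have [XY|YX] := Ftot X Y FX FY.
      by left=> x [|/XY]; [left|right].
    by right=> x [|/YX]; [left|right].
  move=> x; split.
    by move=> [_ [X FX ->] [|Xx]]; [left|right; exists X].
  move=> [A0x|[X FX Xx]]; first by exists (fun x => A0 x \/ A x); [exists A|left].
  by exists (fun x => A0 x \/ X x); [exists X|right].
exists (fun x => A0 x \/ A x); split=> // [x A0x|B PB AB x Bx]; first by left.
apply: contrapT => nAx; apply: (maxA B).
  split=> [y Ay|/(_ x Bx) Ax]; first by apply: AB; right.
  by apply: nAx; right.
by apply: Pext PB => y; split=> [|[/or_introl/AB|]] //; right.
Qed.

Section JacobsonRadical.
Variable R : nzRingType.
Implicit Types (x y r u : R) (L : R -> Prop).

Lemma left_idealN L x : left_ideal L -> L x -> L (- x).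
Proof. by case=> _ _ LM Lx; rewrite -mulN1r; apply: LM. Qed.

Lemma left_idealB L x y : left_ideal L -> L x -> L y -> L (x - y).
Proof. by move=> idL Lx Ly; case: (idL) => _ LD _; apply: LD => //; exact: left_idealN. Qed.

Lemma left_ideal_proper1 L : left_ideal L -> proper_pred L -> ~ L 1.
Proof. by case=> _ _ LM [x Lx] L1; apply: Lx; rewrite -[x]mulr1; exact: LM. Qed.

Lemma left_ideal_chain (F : (R -> Prop) -> Prop) :
  (exists A, F A) -> (forall A, F A -> left_ideal A) ->
  (forall A B, F A -> F B -> subp A B \/ subp B A) ->
  left_ideal (fun x => exists2 A, F A & A x).
Proof.
move=> [A0 FA0] Fid Ftot; split.
- by exists A0 => //; case: (Fid _ FA0).
- move=> x y [A FA Ax] [B FB By]; have [AB|BA] := Ftot A B FA FB.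
    by exists B => //; case: (Fid _ FB) => _ BD _; apply: BD => //; exact: AB.
  by exists A => //; case: (Fid _ FA) => _ AD _; apply: AD => //; exact: BA.
- by move=> r x [A FA Ax]; exists A => //; case: (Fid _ FA) => _ _; apply.
Qed.

Lemma left_ideal_in_maximal L : left_ideal L -> proper_pred L ->
  exists2 m, maximal_left_ideal m & subp L m.
Proof.
move=> idL prL; pose P (A : R -> Prop) := left_ideal A /\ ~ A 1.
have [||m [[idm m1] Lm maxm]] := @zorn_above R P L.
- by split=> //; exact: left_ideal_proper1.
- move=> F F0 FP Ftot; split; last by case=> A /FP[].
  by apply: left_ideal_chain => // A /FP[].
exists m => //; split=> //; first by exists 1.
by move=> L' idL' mL' prL'; apply: maxm => //; split=> //; exact: left_ideal_proper1.
Qed.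

Definition lideal_add1 L x : R -> Prop := fun y => exists l r, L l /\ y = l + r * x.

Lemma lideal_add1_ideal L x : left_ideal L -> left_ideal (lideal_add1 L x).
Proof.
case=> L0 LD LM; split.
- by exists 0, 0; rewrite mul0r addr0.
- move=> _ _ [l [r [Ll ->]]] [l' [r' [Ll' ->]]]; exists (l + l'), (r + r').
  by split; [exact: LD|rewrite mulrDl addrACA].
- move=> s _ [l [r [Ll ->]]]; exists (s * l), (s * r).
  by split; [exact: LM|rewrite mulrDr mulrA].
Qed.

Lemma maximal_left_ideal_bezout L x : maximal_left_ideal L -> ~ L x ->
  exists r, L (1 - r * x).
Proof.
case=> idL _ maxL Lx; have [L0 _ _] := idL.
have [[l [r [Ll e1]]]|n1] := pselect (lideal_add1 L x 1).
  by exists r; rewrite e1 addrK.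
case: Lx; apply: (maxL (lideal_add1 L x)).
- exact: lideal_add1_ideal.
- by move=> l Ll; exists l, 0; rewrite mul0r addr0.
- by exists 1.
- by exists 0, 1; rewrite mul1r add0r.
Qed.

(** If [1 - r * x] has no left inverse, the left ideal it generates lies in a maximal one, which
    would contain [x] and hence [1]. Conversely, if [x] is outside a maximal [L], some [1 - r * x]
    lies in [L]. *)
Lemma jacobsonP x : jacobson x <-> forall r, exists u, u * (1 - r * x) = 1.
Proof.
split=> [Jx r|inv L maxL]; last first.
  have [//|/(maximal_left_ideal_bezout maxL)[r Lrx]] := pselect (L x).
  have [u ux] := inv r; have [idL prL _] := maxL.
  by case: (left_ideal_proper1 idL prL); rewrite -ux; case: idL => _ _; apply.
apply: contrapT => ninv; pose L y := exists u, y = u * (1 - r * x).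
have idL : left_ideal L.
  split=> [|_ _ [u ->] [v ->]|v _ [u ->]]; first by exists 0; rewrite mul0r.
    by exists (u + v); rewrite mulrDl.
  by exists (v * u); rewrite mulrA.
have [|m maxm Lm] := left_ideal_in_maximal idL.
  by exists 1 => -[u u1]; apply: ninv; exists u.
have [idm prm _] := maxm; apply: (left_ideal_proper1 idm prm).
rewrite -[1](subrK (r * x)); case: (idm) => _ mD mM; apply: mD.
  by apply: Lm; exists 1; rewrite mul1r.
by apply: mM; exact: Jx.
Qed.

Lemma jacobson_left_ideal : left_ideal (jacobson (R := R)).
Proof.
split=> [L [[]]|x y Jx Jy L maxL|r x Jx L maxL] //.
  by have [[_ LD _] _ _] := maxL; apply: LD; [exact: Jx|exact: Jy].
by have [[_ _ LM] _ _] := maxL; apply: LM; exact: Jx.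
Qed.

(** A left inverse [u] of [1 - x] equals [1 + u * x], so it has a left inverse too, which must be
    [1 - x]. *)
Lemma jacobson_inv x : jacobson x -> exists u, u * (1 - x) = 1 /\ (1 - x) * u = 1.
Proof.
move=> Jx; have [u] := (jacobsonP x).1 Jx 1; rewrite mul1r => ux.
have uE : u = 1 - (- u) * x by rewrite mulNr opprK -[X in X + _]ux mulrBr mulr1 subrK.
have [v] := (jacobsonP x).1 Jx (- u); rewrite -uE => vu.
have vE : v = 1 - x by rewrite -[LHS]mulr1 -[in LHS]ux mulrA vu mul1r.
by exists u; split=> //; rewrite -vE.
Qed.

(** Stability on the right passes from [1 - b * a] to [1 - a * b], with [a = s * x] and [b = r]: if
    [u] inverts the former, [1 + a * u * b] inverts the latter. *)
Lemma jacobson_ideal : two_sided_ideal (jacobson (R := R)).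
Proof.
have [J0 JD JM] := jacobson_left_ideal; split=> // r x Jx.
apply/jacobsonP => s; have [u [u1 u2]] := jacobson_inv (JM (r * s) _ Jx).
exists (1 + s * x * u * r).
rewrite mulrDl mul1r -[_ * (1 - _)](_ : s * x * (u * (1 - r * s * x)) * r = _).
  by rewrite u1 mulr1 !mulrA subrK.
by rewrite !mulrBr !mulrBl !mulr1 !mulrA.
Qed.

Lemma jacobson_proper : proper_pred (jacobson (R := R)).
Proof.
exists 1 => /jacobson_inv[u [+ _]]; rewrite subrr mulr0 => /esym/eqP.
by rewrite oner_eq0.
Qed.

End JacobsonRadical.

(** The inverses from [jacobson_inv] are two-sided, so the left and right criteria for the radical
    agree. *)
Lemma jacobson_sub_conv (R : nzRingType) (x : R) :
  jacobson (R := R) x -> jacobson (R := R^c) x.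
Proof.
move=> Jx; apply/(jacobsonP (R := R^c)) => r.
have [_ _ _ JM] := jacobson_ideal R.
by have [u [_ xu]] := jacobson_inv (JM r _ Jx); exists u.
Qed.

Lemma jacobson_conv (R : nzRingType) (x : R) :
  jacobson (R := R^c) x <-> jacobson (R := R) x.
Proof.
split; last exact: jacobson_sub_conv.
move=> Jx; apply/(jacobsonP (R := R)) => r.
have [_ _ _ JM] := jacobson_ideal R^c.
by have [u [_ xu]] := jacobson_inv (JM r _ Jx); exists u.
Qed.

(** Semisimplicity of [R / J(R)] expressed inside [R], so that no factor ring has to be chosen. *)
Definition left_complemented (R : nzRingType) : Prop :=
  forall L : R -> Prop, left_ideal L ->
    exists L' : R -> Prop, [/\ left_ideal L', (forall x, L x -> L' x -> jacobson x) &
      (forall x, exists a b, [/\ L a, L' b & x = a + b])].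

Section FactorIdeals.
Variables (R S : nzRingType) (f : {rmorphism R -> S}).
Hypothesis f_surj : surjective f.

Lemma left_ideal_image (L : R -> Prop) :
  left_ideal L -> left_ideal (fun y => exists2 x, L x & f x = y).
Proof.
case=> L0 LD LM; split.
- by exists 0; rewrite ?rmorph0.
- by move=> _ _ [x Lx <-] [y Ly <-]; exists (x + y); [exact: LD|rewrite rmorphD].
- move=> s _ [x Lx <-]; have [r <-] := f_surj s.
  by exists (r * x); [exact: LM|rewrite rmorphM].
Qed.

Lemma left_ideal_preimage (L : S -> Prop) : left_ideal L -> left_ideal (fun x => L (f x)).
Proof.
case=> L0 LD LM; split=> [|x y Lx Ly|r x Lx].
- by rewrite rmorph0.
- by rewrite rmorphD; exact: LD.
- by rewrite rmorphM; exact: LM.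
Qed.

End FactorIdeals.

Lemma factor_semisimpleE (R S : nzRingType) (f : {rmorphism R -> S}) :
  is_factor_ring f (jacobson (R := R)) ->
  semisimple_artinian S <-> left_complemented R.
Proof.
case=> f_surj kerf; split=> [ssS L idL|cR L idL].
  have [C [idC LC LDC]] := ssS _ (left_ideal_image f_surj idL).
  exists (fun x => C (f x)); split; first exact: left_ideal_preimage.
    by move=> x Lx Cx; apply/kerf/LC => //; exists x.
  move=> x; have [_ [b [[a La <-] Cb fx]]] := LDC (f x).
  exists a, (x - a); split=> //; last by rewrite addrC subrK.
  by rewrite /= rmorphB /= fx addrAC subrr add0r.
have [C [idC LC LDC]] := cR _ (left_ideal_preimage f idL).
exists (fun y => exists2 x, C x & f x = y); split; first exact: left_ideal_image.
  by move=> y Ly [x Cx fx]; rewrite -fx in Ly *; apply/kerf; exact: LC.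
move=> y; have [x <-] := f_surj y; have [a [b [La Cb ->]]] := LDC x.
by exists (f a), (f b); split=> //; [exists b|rewrite rmorphD].
Qed.

Lemma semilocalE (R : nzRingType) : semilocal R <-> left_complemented R.
Proof.
split=> [slR|cR S f facf]; last exact: (factor_semisimpleE facf).2.
have [S [f facf]] := factor_ringP (jacobson_ideal R) (jacobson_proper R).
exact: (factor_semisimpleE facf).1 (slR _ _ facf).
Qed.

(** * Left-right symmetry of semisimplicity *)

Section SemisimpleConverse.
Variable B : nzRingType.
Hypothesis ssB : semisimple_artinian B.

(** Split [1 = e + e'] along [L] and a complement: for [x] in [L], the element [x * e' = x - x * e]
    lies in both and vanishes. *)
Lemma semisimple_left_ideal_idempotent (L : B -> Prop) : left_ideal L ->
  exists2 e, L e & forall x, L x -> x = x * e.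
Proof.
move=> idL; have [L' [idL' LL' LDL']] := ssB idL.
have [e [e' [Le L'e' e1]]] := LDL' 1; exists e => // x Lx.
have [_ _ L'M] := idL'; have [_ _ LM] := idL.
have xE : x = x * e + x * e' by rewrite -mulrDr -e1 mulr1.
rewrite {1}xE (LL' (x * e')) ?addr0 //; last exact: L'M.
have -> : x * e' = x - x * e by rewrite {2}xE addrAC subrr add0r.
by apply: left_idealB => //; exact: LM.
Qed.

Lemma principal_left_ideal (x : B) : left_ideal (fun y => exists r, y = r * x).
Proof.
split=> [|_ _ [r ->] [s ->]|r _ [s ->]]; first by exists 0; rewrite mul0r.
  by exists (r + s); rewrite mulrDl.
by exists (r * s); rewrite mulrA.
Qed.

Lemma semisimple_regular (x : B) : exists s, x = x * s * x.
Proof.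
have [_ [s ->] xE] := semisimple_left_ideal_idempotent (principal_left_ideal x).
by exists s; rewrite -mulrA; apply: xE; exists 1; rewrite mul1r.
Qed.

(* [B] is left noetherian, so [B f] can be chosen maximal among the idempotents
   [f] of [K]; a [k] in [K] outside [f B] would then produce, by regularity, an
   idempotent [f + g'] of [K] with [f g' = g' f = 0] and [g' <> 0]. *)
Lemma semisimple_right_ideal_idempotent (K : B -> Prop) :
  left_ideal (K : B^c -> Prop) -> exists2 f, K f & forall x, K x -> x = f * x.
Proof.
case=> K0 KD KM; have {}KM r x : K x -> K (x * r) by exact: (KM r x).
have KB x y : K x -> K y -> K (x - y).
  by move=> Kx Ky; apply: KD => //; rewrite -mulrN1; exact: KM.
pose P (A : B -> Prop) := exists f, [/\ f * f = f, K f & A = fun y => exists r, y = r * f].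
have [||A [[f [ff Kf AE]] _ maxA]] := @zorn_above B P (fun y => exists r, y = r * 0).
- by exists 0; rewrite mul0r.
- move=> F F0 FP Ftot; have [|e [A FA Ae] eP] := @semisimple_left_ideal_idempotent
    (fun x => exists2 A, F A & A x).
    apply: left_ideal_chain => // A /FP[f [_ _ ->]]; exact: principal_left_ideal.
  have [f [ff Kf AE]] := FP A FA; exists f; split=> //; rewrite -AE.
  apply: funext => x; apply: propext; split=> [/eP ->|Ax]; last by exists A.
  by move: Ae; rewrite AE => -[r ->]; exists (x * r); rewrite mulrA.
exists f => // k Kk.
have [s xs] := semisimple_regular (k - f * k); set x := k - f * k in xs.
have Kx : K x by apply: KB => //; exact: KM.
have fx : f * x = 0 by rewrite mulrBr mulrA ff subrr.
have [g [xE Kg fg gg]] : exists g, [/\ x = g * x, K g, f * g = 0 & g * g = g].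
  exists (x * s); split; [by []|exact: KM|by rewrite mulrA fx mul0r|].
  by rewrite mulrA -xs.
have fgf : f * (g * f) = 0 by rewrite mulrA fg mul0r.
(* Only [f * g = 0] is known so far; removing [g * f] gives orthogonality to [f] on both sides. *)
pose g' := g - g * f.
have fg' : f * g' = 0 by rewrite /g' mulrBr fgf fg subrr.
have g'f : g' * f = 0 by rewrite /g' mulrBl -mulrA ff subrr.
have gg' : g * g' = g' by rewrite /g' mulrBr mulrA gg.
have g'g' : g' * g' = g'.
  by rewrite {1}/g' mulrBl -mulrA fg' mulr0 subr0 gg'.
have fe : f * (f + g') = f by rewrite mulrDr ff fg' addr0.
have g'e : g' * (f + g') = g' by rewrite mulrDr g'f add0r g'g'.
have: A (f + g').
  apply: (maxA (fun y => exists r, y = r * (f + g'))).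
  - exists (f + g'); split=> //; last by apply: KD => //; apply: KB => //; exact: KM.
    by rewrite mulrDl fe g'e.
  - by move=> y; rewrite AE => -[r ->]; exists (r * f); rewrite -mulrA fe.
  - by exists 1; rewrite mul1r.
rewrite AE => -[r rE].
(* Right multiplication by [f] fixes [f + g'], an element of [B f], and this kills [g']; then
   [g = g * f] gives [g = g * f * g = 0]. *)
have g'0 : g' = 0.
  have: (f + g') * f = f + g' by rewrite rE -mulrA ff.
  by rewrite mulrDl ff g'f addr0 => /esym/(canRL (addKr _)) ->; rewrite addNr.
have gE : g = g * f by apply/eqP; rewrite -subr_eq0 -/g' g'0.
have g0 : g = 0 by rewrite -gg {1}gE -mulrA fg mulr0.
by apply/eqP; rewrite -subr_eq0 -/x xE g0 mul0r eqxx.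
Qed.

(** A right ideal is [f B] for an idempotent [f]; the elements killed by [f] on the left form the
    complement [(1 - f) B]. *)
Lemma semisimple_conv : semisimple_artinian B^c.
Proof.
move=> K idK; have [f Kf fP] := semisimple_right_ideal_idempotent idK.
have ff : f * f = f by rewrite -fP.
have [_ _ idKM] := idK; have KM (r x : B) : K x -> K (x * r) by exact: (idKM r x).
exists (fun x => f * (x : B) = 0); split.
- split=> [|x y fx fy|r x fx]; first exact: mulr0.
    by rewrite mulrDr fx fy addr0.
  have -> : r * x = (x : B) * (r : B) by [].
  by rewrite mulrA fx mul0r.
- by move=> x /fP {2}->.
- move=> x; exists (f * (x : B)), ((x : B) - f * (x : B)); split.
  + exact: KM.
  + by rewrite mulrBr mulrA ff subrr.
  + by rewrite addrC subrK.
Qed.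

End SemisimpleConverse.

(** The symmetry holds in [S = R / J(R)], and [S^c] is the factor of [R^c] by its radical, since the
    two radicals coincide. *)
Lemma left_complemented_conv (R : nzRingType) :
  left_complemented R -> left_complemented R^c.
Proof.
move=> cR.
have [S [f facf]] := factor_ringP (jacobson_ideal R) (jacobson_proper R).
pose fc : R^c -> S^c := f.
have fc_zmod : zmod_morphism fc by move=> x y; exact: (rmorphB f x y).
have fc_mon : monoid_morphism fc.
  by split; [exact: (rmorph1 f)|move=> x y; exact: (rmorphM f y x)].
pose g : {rmorphism R^c -> S^c} := HB.pack fc
  (GRing.isZmodMorphism.Build _ _ fc fc_zmod) (GRing.isMonoidMorphism.Build _ _ fc fc_mon).
have facg : is_factor_ring g (jacobson (R := R^c)).
  case: facf => f_surj kerf; split; first exact: f_surj.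
  by move=> x; rewrite jacobson_conv; exact: kerf.
exact/(factor_semisimpleE facg).1/semisimple_conv/(factor_semisimpleE facf).2.
Qed.

Lemma left_complemented_convE (R : nzRingType) :
  left_complemented R <-> left_complemented R^c.
Proof.
split; first exact: left_complemented_conv.
move=> /left_complemented_conv cR L idL.
have [//|L' [idL' LL' LDL']] := cR (L : R^c^c -> Prop).
by exists L'; split=> // x Lx L'x; apply/jacobson_conv/jacobson_conv; exact: LL'.
Qed.

(** * Free modules and projective covers *)

Section FreeModules.
Variables (T : nzRingType) (K : choiceType).
Local Notation F := {freeg K / T}.

Definition fbasis (k : K) : F := Freeg [:: (1, k)].

Lemma coeff_fbasis j k : coeff j (fbasis k) = (k == j)%:R.
Proof. by rewrite coeffU mul1r. Qed.

Lemma freeg_coeff_inj (p q : F) : (forall k, coeff k p = coeff k q) -> p = q.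
Proof. by move=> pq; apply/eqP/freeg_eqP. Qed.

Lemma freeg_basisE (q : F) : q = \sum_(k <- dom q) coeff k q *: fbasis k.
Proof.
rewrite -[LHS]freeg_sumE; apply: eq_bigr => k _; apply: freeg_coeff_inj => j.
by rewrite coeffZ !coeffU mul1r.
Qed.

Variable M : lmodType T.

Lemma fglift_linear (y : K -> M) : linear (fglift y : F -> M).
Proof.
have liftB : {morph fglift y : p q / p - q} by exact: lift_is_additive.
have lift0 : fglift y 0 = 0 by rewrite -[0](subrr 0) liftB subrr.
have liftD : {morph fglift y : p q / p + q}.
  by move=> p q; rewrite -[q in LHS]opprK -[- q]sub0r !liftB lift0 sub0r opprK.
have lift_sum (s : seq K) (G : K -> F) :
    fglift y (\sum_(k <- s) G k) = \sum_(k <- s) fglift y (G k).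
  by elim/big_rec2: _ => // k u v _ <-; rewrite liftD.
move=> a p q; rewrite liftD; congr (_ + _).
rewrite -[p in RHS]freeg_sumE lift_sum scaler_sumr.
rewrite -[LHS]/(fglift y (fgscale a p)) /fgscale lift_sum.
by apply: eq_bigr => k _; rewrite !liftU scalerA.
Qed.

Lemma free_lift (y : K -> M) : exists h : {linear F -> M}, forall k, h (fbasis k) = y k.
Proof.
exists (mk_linear (fglift_linear y)) => k.
by rewrite -[LHS]/(fglift y (fbasis k)) liftU scale1r.
Qed.

Lemma linear_freeE (h : {linear F -> M}) q :
  h q = \sum_(k <- dom q) coeff k q *: h (fbasis k).
Proof.
by rewrite {1}[q]freeg_basisE linear_sum; apply: eq_bigr => k _; rewrite linearZZ.
Qed.

Lemma linear_free_ext (f g : {linear F -> M}) :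
  (forall k, f (fbasis k) = g (fbasis k)) -> f =1 g.
Proof. by move=> fg q; rewrite !linear_freeE; apply: eq_bigr => k _; rewrite fg. Qed.

Lemma linear_free_sub (h : {linear F -> M}) (W : M -> Prop) : submodule W ->
  (forall k, W (h (fbasis k))) -> forall q, W (h q).
Proof.
move=> subW Wh q; rewrite linear_freeE; apply: submod_sum => // k _.
exact: submodZ.
Qed.

End FreeModules.

Lemma projective_free (T : nzRingType) (K : choiceType) :
  projective ({freeg K / T} : lmodType T).
Proof.
move=> M N g f g_surj; pose y k := projT1 (cid (g_surj (f (fbasis T k)))).
have gy k : g (y k) = f (fbasis T k) by rewrite /y; case: cid.
have [h hy] := free_lift y; exists h.
by apply: (linear_free_ext (f := g \o h)) => k; rewrite /= hy.
Qed.

Lemma projective_regular (T : nzRingType) : projective (T^o : lmodType T).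
Proof.
move=> M N g f g_surj; have [y gy] := g_surj (f 1).
have lin_h : linear (fun r : T^o => r *: y).
  by move=> a u v; rewrite scalerDl scalerA.
exists (mk_linear lin_h) => r; rewrite -[mk_linear lin_h r]/(r *: y) linearZZ gy.
by rewrite -linearZZ; congr (f _); exact: mulr1.
Qed.

(** [pi] lifts through [p] to [h]; the image of [h] and the kernel of [p] span [P], so [h] is onto,
    and projectivity of [P] splits it. Thus [P] is a direct summand of [F]. *)
Lemma projective_cover_lift (T : nzRingType) (F P N : lmodType T)
    (pi : {linear F -> N}) (p : {linear P -> N}) :
  projective F -> projective P -> surjective pi -> surjective p ->
  superfluous (fun x => p x = 0) ->
  exists (h : {linear F -> P}) (s : {linear P -> F}),
    (forall x, p (h x) = pi x) /\ (forall v, h (s v) = v).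
Proof.
move=> projF projP pi_surj p_surj sup_p.
have [h hP] := projF _ _ p pi p_surj.
have h_surj : surjective h.
  move=> v; have [||] := sup_p (fun u => exists x, h x = u) _ _ v.
  - split=> [|a _ _ [x <-] [y <-]]; first by exists 0; rewrite linear0.
    by exists (a *: x + y); rewrite linearP.
  - move=> u; have [x px] := pi_surj (p u); exists (u - h x), (h x).
    by split; [rewrite linearB hP px subrr|exists x|rewrite subrK].
  - by move=> x hx; exists x.
have [s hs] := projP _ _ h idfun h_surj.
by exists h, s.
Qed.

(** The cover [P] of the cyclic module [T / L] is a direct summand of [T], and its copy in [T]
    complements [L] modulo the radical. *)
Lemma projective_covers_left_complemented (T : nzRingType) :
  (forall M : lmodType T, has_projective_cover M) -> left_complemented T.
Proof.
move=> pc L idL.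
have subL : submodule (L : T^o -> Prop).
  by case: idL => L0 LD LM; split=> // a x y Lx Ly; apply: LD => //; exact: LM.
have [N [pi [pi_surj kerpi]]] := quotient_moduleP subL.
have [P [p [projP p_surj sup_p]]] := pc N.
have [h [s [hP hs]]] :=
  projective_cover_lift (@projective_regular T) projP pi_surj p_surj sup_p.
exists (fun x => exists v, s v = x); split.
- split=> [|_ _ [u <-] [v <-]|r _ [u <-]]; first by exists 0; rewrite linear0.
    by exists (u + v); rewrite linearD.
  by exists (r *: u); rewrite linearZZ.
- move=> x /kerpi + [u xu]; rewrite -xu -hP hs => pu m maxm.
  (* If [m] missed [s u], then [1 - r * (s u)] in [m] shows that the kernel of [p], which contains
     [u], and the preimage of [m] span [P]; superfluity puts [s u] back in [m]. *)
  have [//|/(maximal_left_ideal_bezout maxm)[r mr]] := pselect (m (s u)).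
  have [[m0 mD mM] _ _] := maxm.
  apply: (sup_p (fun v => m (s v))).
    split=> [|a v w mv mw]; first by rewrite linear0.
    by rewrite linearP; apply: mD => //; exact: mM.
  move=> v; exists (((s v : T) * r) *: u), (v - ((s v : T) * r) *: u); split.
  + by rewrite linearZZ pu scaler0.
  + have := mM (s v) _ mr; rewrite mulrBr mulr1 mulrA.
    by rewrite linearB linearZZ.
  + by rewrite addrC subrK.
- move=> x; exists (x - s (h x)), (s (h x)); split; [|by exists (h x)|by rewrite subrK].
  by apply/kerpi; rewrite linearB -!hP hs subrr.
Qed.

(* T-nilpotence of the radical without sequences: by dependent choice it says that
   [j_0 * j_1 * ... * j_n] eventually vanishes for every sequence in [J(T)]; on
   [T := S^c] these are the products [j_n ... j_0] of [S]. *)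
Definition t_nilpotent_radical (T : nzRingType) : Prop :=
  forall Q : T -> Prop, (exists a, Q a) ->
    (forall a, Q a -> exists2 j, jacobson j & Q (a * j)) -> Q 0.

Section RadicalFree.
Variable T : nzRingType.
Local Notation J := (jacobson (R := T)).

(** One unknown is eliminated at a time: [1 - a k k] is invertible, and the substituted system still
    has its coefficients in the radical. *)
Lemma jacobson_row_system (K : eqType) (s : seq K) (x : K -> T) (a : K -> K -> T) :
  (forall i j, J (a i j)) -> (forall j, j \in s -> x j = \sum_(i <- s) x i * a i j) ->
  forall j, j \in s -> x j = 0.
Proof.
have [_ JD JMl JMr] := jacobson_ideal T.
elim: s a => [//|k s IHs] a Ja xE.
have [u [_ ku]] := jacobson_inv (Ja k k).
have xk : x k = \sum_(i <- s) x i * (a i k * u).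
  rewrite -[x k]mulr1 -ku mulrA mulrBr mulr1 {1}xE ?mem_head // big_cons addrAC subrr add0r.
  by rewrite mulr_suml; apply: eq_bigr => i _; rewrite mulrA.
have xs j : j \in s -> x j = 0.
  apply: (IHs (fun i j => a i k * u * a k j + a i j)) => [i l|l sl].
    by apply: JD => //; apply: JMl.
  rewrite xE ?inE ?sl ?orbT // big_cons xk mulr_suml -big_split.
  by apply: eq_bigr => i _; rewrite mulrDr !mulrA.
move=> j; rewrite inE => /predU1P[->|]; last exact: xs.
by rewrite xk big_seq big1 // => i /xs ->; rewrite mul0r.
Qed.

Variable K : choiceType.
Local Notation F := ({freeg K / T} : lmodType T).

(** The submodule [J F] of the free module, described by coefficients. *)
Definition free_radical (q : F) : Prop := forall k, J (coeff k q).

Lemma free_radical_submodule : submodule free_radical.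
Proof.
have [J0 JD JMl _] := jacobson_ideal T; split=> [k|a p q Jp Jq k].
  by rewrite coeff0.
by rewrite coeffD coeffZ; apply: JD => //; exact: JMl.
Qed.

(* If [e_i] are the basis vectors, comparing coefficients in
   [x = \sum_i x_i (pi e_i)] gives [x_j = \sum_i x_i a_ij] with [a_ij] in [J]. *)
Lemma radical_idempotent_zero (pi : {linear F -> F}) :
  (forall q, pi (pi q) = pi q) -> (forall q, free_radical (pi q)) ->
  forall q, pi q = 0.
Proof.
move=> pipi Jpi q; set x := pi q.
have pix : x = pi x by rewrite pipi.
have x0 := @jacobson_row_system K (dom x) (fun k => coeff k x)
  (fun i j => coeff j (pi (fbasis T i))).
apply: freeg_coeff_inj => j; rewrite coeff0.
have [jx|/coeff_outdom//] := boolP (j \in dom x).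
apply: x0 => // [i l|l _]; first exact: Jpi.
rewrite {1}pix linear_freeE raddf_sum.
by apply: eq_bigr => i _; rewrite /= coeffZ.
Qed.

Lemma free_radical_superfluous :
  (forall M : lmodType T, has_projective_cover M) -> superfluous free_radical.
Proof.
move=> pc.
have [N [pi [pi_surj kerpi]]] := quotient_moduleP free_radical_submodule.
have [P [p [projP p_surj sup_p]]] := pc N.
have [h [s [hP hs]]] :=
  projective_cover_lift (@projective_free T K) projP pi_surj p_surj sup_p.
have lin_r : linear (fun q => q - s (h q)).
  by move=> a u v; rewrite (linearP h) (linearP s) scalerBr opprD addrACA.
have sh q : q = s (h q).
  apply/eqP; rewrite -subr_eq0; apply/eqP.
  apply: (radical_idempotent_zero (pi := mk_linear lin_r)) => u /=.
    rewrite -[LHS]/(u - s (h u) - s (h (u - s (h u)))).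
    by rewrite (linearB h) hs subrr (linear0 s) subr0.
  by apply/kerpi; rewrite (linearB pi) -!hP hs subrr.
move=> G subG FG q; rewrite [q]sh.
suff [g Gg <-] : exists2 g, G g & h g = h q by rewrite -sh.
apply: (sup_p (fun v => exists2 g, G g & h g = v)).
  split=> [|a _ _ [u Gu <-] [v Gv <-]]; first by exists 0; [exact: submod0|rewrite linear0].
  by exists (a *: u + v); [exact: subG.2|rewrite linearP].
move=> v; have [j [g [Jj Gg sv]]] := FG (s v).
exists (h j), (h g); split; [|by exists g|by rewrite -linearD -sv hs].
by rewrite hP; apply/kerpi.
Qed.

End RadicalFree.

(* For the free module on [e_0, e_1, ...] the vectors [e_n - j_n e_(n+1)] generate
   it modulo its radical, hence generate it; writing [e_0] in terms of them forces
   the products [j_0 ... j_n] to vanish eventually. *)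
Lemma projective_covers_t_nilpotent (T : nzRingType) :
  (forall M : lmodType T, has_projective_cover M) -> t_nilpotent_radical T.
Proof.
move=> pc Q [q0 Qq0] Qstep; apply: contrapT => nQ0.
have next a : exists j, Q a -> jacobson j /\ Q (a * j).
  have [/Qstep[j Jj Qj]|nQa] := pselect (Q a); first by exists j.
  by exists 0.
pose nx a := projT1 (cid (next a)).
have nxP a : Q a -> jacobson (nx a) /\ Q (a * nx a) by rewrite /nx; case: cid.
(* [b n] is the product [q0 * j_0 * ... * j_(n-1)] with [j_n = nx (b n)]. *)
pose b := fix b n := if n is n'.+1 then b n' * nx (b n') else q0.
have Qb n : Q (b n) by elim: n => //= n /nxP[].
have [psi psiE] := free_lift (fun n => nx (b n) *: fbasis T n.+1).
have [J0 _ JMl JMr] := jacobson_ideal T.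
have Jpsi q : free_radical (psi q).
  apply: linear_free_sub; first exact: free_radical_submodule.
  move=> n k; rewrite psiE coeffZ; apply: JMr; exact: (nxP _ (Qb n)).1.
have coeff_psi0 q : coeff 0%N (psi q) = 0.
  rewrite linear_freeE raddf_sum big1 // => i _ /=.
  by rewrite psiE !coeffZ coeff_fbasis !mulr0.
have coeff_psiS n q : coeff n.+1 (psi q) = coeff n q * nx (b n).
  rewrite linear_freeE {3}[q]freeg_basisE !raddf_sum mulr_suml; apply: eq_bigr => i _ /=.
  rewrite psiE !coeffZ !coeff_fbasis eqSS.
  by case: eqP => [->|_]; rewrite ?mulr1 // !mulr0 mul0r.
have [||c cE] :=
  @free_radical_superfluous T nat pc (fun q => exists c, q = c - psi c) _ _ (fbasis T 0%N).
- split=> [|a _ _ [u ->] [v ->]]; first by exists 0; rewrite linear0 subr0.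
  by exists (a *: u + v); rewrite linearP scalerBr opprD addrACA.
- move=> q; exists (psi q), (q - psi q); split=> //; first by exists q.
  by rewrite addrC subrK.
have cn n : (0%N == n)%:R = coeff n c - coeff n (psi c).
  by rewrite -coeffB -cE coeff_fbasis.
(* Coefficients in [e_0 = c - psi c] give [c_0 = 1] and [c_(n+1) = c_n * j_n]; the support of [c]
   being finite, some [b n] is then zero. *)
have coeff_c n : q0 * coeff n c = b n.
  elim: n => [|n IHn]; first by rewrite -[coeff _ _]subr0 -(coeff_psi0 c) -cn mulr1.
  have := cn n.+1; rewrite coeff_psiS => /esym/eqP; rewrite subr_eq0 => /eqP ->.
  by rewrite mulrA IHn.
have [n nc] : exists n, n \notin dom c.
  exists (\max_(i <- dom c) i).+1; apply/negP => nc.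
  by have := leq_bigmax_seq (P := xpredT) (F := id) _ nc isT; rewrite ltnn.
by apply: nQ0; move: (Qb n); rewrite -coeff_c (coeff_outdom nc) mulr0.
Qed.

(** * Existence of projective covers *)

Section RadicalMultiples.
Variables (T : nzRingType) (M : lmodType T).

(** The submodule [J M], as the intersection of all submodules containing the products [j *: m];
    this avoids explicit finite sums. *)
Definition radical_mul (x : M) : Prop := forall N : M -> Prop, submodule N ->
  (forall j m, jacobson j -> N (j *: m)) -> N x.

Lemma radical_mul_submodule : submodule radical_mul.
Proof.
split=> [N subN _|a x y Jx Jy N subN JN]; first exact: submod0.
by apply: subN.2; [exact: Jx|exact: Jy].
Qed.

Lemma radical_mulZ j m : jacobson j -> radical_mul (j *: m).
Proof. by move=> Jj N _; apply. Qed.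

(** As [M = N + J M], an [a] with [a M] not inside [N] has a multiple [a * j] of the same kind;
    T-nilpotence would make [0] such an element. *)
Lemma t_nilpotent_nakayama (N : M -> Prop) : t_nilpotent_radical T -> submodule N ->
  (forall x, exists2 n, N n & radical_mul (x - n)) -> forall x, N x.
Proof.
move=> tnil subN NJ x; apply: contrapT => Nx.
have [||y []] := tnil (fun a => exists y, ~ N (a *: y)).
- by exists 1, x; rewrite scale1r.
- move=> a [y Nay]; apply: contrapT => nj; apply: Nay.
  have [_ _ JMl _] := jacobson_ideal T.
  (* Letting [r] vary makes [W] a submodule; if no [j] worked, it would contain [J M] as well as
     [N], hence [y]. *)
  pose W z := forall r, N ((a * r) *: z).
  have subW : submodule W.
    split=> [r|b u v Wu Wv r]; first by rewrite scaler0; exact: submod0.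
    by rewrite scalerDr; apply: submodD => //; rewrite scalerA -mulrA.
  have JW j m : jacobson j -> W (j *: m).
    move=> Jj r; rewrite scalerA -mulrA; apply: contrapT => nN; apply: nj.
    by exists (r * j); [exact: JMl|exists m].
  have [n Nn Jyn] := NJ y.
  suff /(_ 1) : W y by rewrite mulr1.
  rewrite -(subrK n y); apply: (submodD subW); first exact: (Jyn W subW JW).
  by move=> r; exact: (submodZ subN).
- by rewrite scale0r; exact: submod0.
Qed.

End RadicalMultiples.

Lemma t_nilpotent_nil (T : nzRingType) (j : T) :
  t_nilpotent_radical T -> jacobson j -> exists n, j ^+ n = 0.
Proof.
move=> tnil Jj; have [||n ->] := tnil (fun a => exists n, a = j ^+ n).
- by exists 1, 0%N.
- by move=> _ [n ->]; exists j => //; exists n.+1; rewrite exprSr.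
- by exists n.
Qed.

(* Newton iteration [x |-> 3 x^2 - 2 x^3] for the equation [x^2 = x]. *)
Lemma idempotent_lift (T : nzRingType) (x : T) : t_nilpotent_radical T ->
  jacobson (x - x * x) -> exists2 e, e * e = e & jacobson (e - x).
Proof.
move=> tnil Jx; have [n xn] := t_nilpotent_nil tnil Jx.
have [J0 JD JMl JMr] := jacobson_ideal T.
(* A power of two is convenient because each iteration halves the exponent. *)
have : (x - x * x) ^+ (2 ^ n) = 0.
  by rewrite -(subnK (ltnW (ltn_expl n (ltnSn 1)))) exprD xn mulr0.
elim: n x {xn} Jx => [|n IHn] x Jx.
  by rewrite expr1 => /eqP; rewrite subr_eq0 => /eqP xx; exists x; rewrite ?subrr.
have cx : commr_rmorph (intr : int -> T) x by move=> z; exact: commr_int.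
(* All identities involve only [x], so they are checked in the commutative ring of integer
   polynomials and evaluated at [x]. *)
pose psi : {rmorphism {poly int} -> T} := horner_morph cx.
have psiX : psi 'X = x by exact: horner_morphX.
pose z : {poly int} := 'X - 'X * 'X.
pose y : {poly int} := 3%:R * 'X ^+ 2 - 2%:R * 'X ^+ 3.
pose w : {poly int} := (3%:R - 2%:R * 'X) * (1 + 2%:R * 'X).
have psiz : psi z = x - x * x by rewrite rmorphB rmorphM psiX.
have yx : y - 'X = z * (2%:R * 'X - 1) by rewrite /y /z; ring.
have yy : y - y * y = z ^+ 2 * w by rewrite /y /z /w; ring.
rewrite -psiz in Jx *; rewrite expnS exprM => zn.
have Jy : jacobson (psi y - psi y * psi y).
  by rewrite -rmorphM -rmorphB yy expr2 -mulrA (rmorphM psi z); exact: JMr.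
have [|e ee Jey] := IHn (psi y) Jy.
  by rewrite -rmorphM -rmorphB yy -rmorphXn exprMn (rmorphM psi) !rmorphXn zn mul0r.
exists e => //; rewrite -(subrK (psi y) e) -addrA; apply: JD => //.
by rewrite -[x in _ - x]psiX -rmorphB yx (rmorphM psi z); apply: JMr.
Qed.

(** With [1 = k + k'] along [L] and a complement, [k' - k' * k' = k' * k] lies in both, so [k'] is
    idempotent modulo the radical and lifts to [e]. The left ideal [T e] will enlarge a partial
    cover. *)
Lemma left_complemented_idempotent (T : nzRingType) (L : T -> Prop) :
  t_nilpotent_radical T -> left_complemented T ->
  left_ideal L -> proper_pred L -> subp (jacobson (R := T)) L ->
  exists e, [/\ e * e = e, ~ L e & forall r, r * e = r -> L r -> jacobson r].
Proof.
move=> tnil cT idL prL JL; have [L' [idL' LL' LDL']] := cT L idL.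
have [k [k' [Lk L'k' e1]]] := LDL' 1.
have [_ _ LM] := idL; have [_ _ L'M] := idL'.
have kE : k = 1 - k' by rewrite e1 addrK.
have Jk' : jacobson (k' - k' * k').
  apply: LL'; last by apply: left_idealB => //; exact: L'M.
  by rewrite -{1}[k']mulr1 -mulrBr -kE; exact: LM.
have [e ee Jek'] := idempotent_lift tnil Jk'.
have [J0 JD JMl JMr] := jacobson_ideal T.
have eL r : r * e = r -> L r -> jacobson r.
  move=> re Lr; rewrite -re -(subrK k' e) mulrDr; apply: JD; first exact: JMl.
  apply: LL'; last exact: L'M.
  have -> : r * k' = r - r * k by rewrite kE mulrBr mulr1 opprB addrC subrK.
  by apply: left_idealB => //; exact: LM.
exists e; split=> // Le; apply: (left_ideal_proper1 idL prL).
rewrite e1; case: (idL) => _ LD _; apply: LD => //.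
have -> : k' = e - (e - k') by rewrite opprB addrC subrK.
by apply: left_idealB => //; exact: JL.
Qed.

Section ProjectiveCovers.
Variables (T : nzRingType) (M : lmodType T).
Hypothesis tnil : t_nilpotent_radical T.
Hypothesis cT : left_complemented T.

(** A pair [(m, e)] stands for a summand [T e], mapped to [M] by sending [t] to [t *: m]. *)
Definition cover_index : choiceType := (M * T)%type.
Local Notation K := cover_index.
Local Notation F := ({freeg K / T} : lmodType T).

(* The direct sum of the [T e] over the pairs [(m, e)] in [A]. *)
Definition summand (A : K -> Prop) (q : F) : Prop :=
  forall k, (coeff k q != 0 -> A k) /\ coeff k q * k.2 = coeff k q.

Lemma summand_submodule A : submodule (summand A).
Proof.
split=> [k|a p q Ap Aq k]; first by rewrite coeff0 eqxx mul0r.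
rewrite coeffD coeffZ mulrDl -mulrA (Ap k).2 (Aq k).2; split=> //.
have [q0|/(Aq k).1//] := eqVneq (coeff k q) 0.
have [p0|/(Ap k).1//] := eqVneq (coeff k p) 0.
by rewrite p0 q0 mulr0 addr0 eqxx.
Qed.

Lemma summand_fbasis (A : K -> Prop) (k : K) :
  A k -> k.2 * k.2 = k.2 -> summand A (k.2 *: fbasis T k).
Proof.
move=> Ak kk l; rewrite coeffZ coeff_fbasis.
by have [<-|_] := eqVneq k l; rewrite ?mulr1 ?mulr0 ?mul0r ?eqxx.
Qed.

Variable p : {linear F -> M}.
Hypothesis pE : forall k : K, p (fbasis T k) = k.1.

(** The second clause says that the sum of the [T e], modulo its radical, embeds in [M / J M]. *)
Definition independent (A : K -> Prop) : Prop :=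
  (forall k, A k -> k.2 * k.2 = k.2) /\
  (forall q, summand A q -> radical_mul (p q) -> free_radical q).

Lemma chain_seq (G : (K -> Prop) -> Prop) (s : seq K) :
  (exists A, G A) -> (forall A B, G A -> G B -> subp A B \/ subp B A) ->
  (forall k, k \in s -> exists2 A, G A & A k) ->
  exists2 A, G A & forall k, k \in s -> A k.
Proof.
move=> [A0 GA0] Gtot; elim: s => [_|k s IHs Gs]; first by exists A0.
have [|A GA As] := IHs; first by move=> l ls; apply: Gs; rewrite inE ls orbT.
have [|B GB Bk] := Gs k; first exact: mem_head.
have [AB|BA] := Gtot A B GA GB; [exists B|exists A] => // l.
  by rewrite inE => /predU1P[->//|/As/AB].
by rewrite inE => /predU1P[->|/As//]; exact: BA.
Qed.

(** Each [q] has finite support, hence over the union of a chain it is supported in one member, and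
    independence passes to the union. *)
Lemma maximal_independent : exists A, independent A /\
  forall B, independent B -> subp A B -> subp B A.
Proof.
have [J0 _ _ _] := jacobson_ideal T.
have [||A [indA _ maxA]] := @zorn_above K independent (fun=> False); last by exists A.
  split=> // q q0 _ k; have [->//|/(q0 k).1//] := eqVneq (coeff k q) 0.
move=> G G0 Gind Gtot; split=> [k [A /Gind[Ae _]]|q qG]; first exact: Ae.
have [|A GA Aq] := @chain_seq G (dom q) G0 Gtot.
  by move=> k; rewrite mem_dom => /(qG k).1.
apply: (Gind A GA).2 => k; split; last exact: (qG k).2.
by rewrite -mem_dom; exact: Aq.
Qed.

(** If [x] is not reached, the [r] with [r *: x] reached form a proper left ideal [L] containing the
    radical. An idempotent [e] outside [L] with [T e] meeting [L] inside the radical lets [(x, e)]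
    be added, against maximality. *)
Lemma independent_generates A : independent A ->
  (forall B, independent B -> subp A B -> subp B A) ->
  forall x, exists2 q, summand A q & radical_mul (x - p q).
Proof.
move=> [Aid Aind] maxA x; have [J0 JD JMl JMr] := jacobson_ideal T.
have subA := summand_submodule A; have subJ := radical_mul_submodule M.
pose N y := exists2 q, summand A q & radical_mul (y - p q).
have subN : submodule N.
  split=> [|a u v [q Aq Ju] [r Ar Jv]].
    by exists 0; [exact: submod0 subA|rewrite linear0 subr0; exact: submod0 subJ].
  exists (a *: q + r); first exact: subA.2.
  by rewrite linearP opprD addrACA -scalerBr; exact: subJ.2.
have JN y : radical_mul y -> N y.
  by move=> Jy; exists 0; [exact: submod0 subA|rewrite linear0 subr0].
apply: contrapT => Nx; pose L r := N (r *: x).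
have idL : left_ideal L.
  split=> [|r s Lr Ls|r s Ls]; rewrite /L.
  - by rewrite scale0r; exact: submod0 subN.
  - by rewrite scalerDl; exact: (submodD subN).
  - by rewrite -scalerA; exact: (submodZ subN).
have [||e [ee Le eL]] := left_complemented_idempotent tnil cT idL.
- by exists 1; rewrite /L scale1r.
- by move=> j Jj; apply: JN; exact: radical_mulZ.
pose b : K := (x, e); pose B k := A k \/ k = b.
have indB : independent B.
  split=> [k [/Aid//|->//]|q Bq Jpq].
  pose r := coeff b q; pose q' := q - r *: fbasis T b.
  have q'E k : coeff k q' = if k == b then 0 else coeff k q.
    rewrite coeffB coeffZ coeff_fbasis eq_sym.
    by case: eqP => [->|_]; rewrite ?mulr1 ?subrr ?mulr0 ?subr0.
  have Aq' : summand A q'.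
    move=> k; rewrite q'E; case: (eqVneq k b) => [_|kb]; first by rewrite eqxx mul0r.
    split; last exact: (Bq k).2.
    by move=> /(Bq k).1[//|kb']; rewrite kb' eqxx in kb.
  have pq : p q' = p q - r *: x by rewrite linearB linearZZ pE.
  (* Modulo [J M], [r *: x] equals [- p q'], so [r] lies in [L] as well as in [T e]. *)
  have Jr : jacobson r.
    apply: eL; first exact: (Bq b).2.
    exists (- q'); first exact: (submodN subA).
    by rewrite linearN opprK pq addrC subrK.
  have Jq' : free_radical q'.
    by apply: Aind => //; rewrite pq; apply: (submodB subJ) => //; exact: radical_mulZ.
  move=> k; have := Jq' k; rewrite q'E; case: (k =P b) => [kb _|//].
  by rewrite kb.
have Ab : A b by apply: (maxA B indB) => [k|]; [left|right].
apply: Le; exists (e *: fbasis T b); first exact: (@summand_fbasis A b).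
by rewrite linearZZ pE subrr; exact: submod0 subJ.
Qed.

(** The sum of the [T e] is a retract of the free module, hence projective. Nakayama's lemma gives
    both surjectivity onto [M] and superfluity of the kernel, which lies in the radical of the
    sum. *)
Lemma independent_cover A : independent A ->
  (forall x, exists2 q, summand A q & radical_mul (x - p q)) ->
  has_projective_cover M.
Proof.
move=> [Aid Aind] Agen; have subA := summand_submodule A.
have [P [i [i_inj iP]]] := submodule_typeP subA.
have [rho0 rho0E] := free_lift (fun k : K =>
  if `[< A k >] then k.2 *: fbasis T k else 0).
have rho0A q : exists v, i v = rho0 q.
  apply/iP; apply: linear_free_sub => // k; rewrite rho0E.
  case: asboolP => [Ak|_]; last exact: submod0.
  exact: summand_fbasis (Aid _ Ak).
have rho0K q : summand A q -> rho0 q = q.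
  move=> Aq; rewrite linear_freeE [RHS]freeg_basisE; apply: eq_big_seq => k.
  rewrite mem_dom => /(Aq k).1 Ak; rewrite rho0E (asboolT Ak).
  by rewrite scalerA (Aq k).2.
pose rho q := projT1 (cid (rho0A q)).
have irho q : i (rho q) = rho0 q by rewrite /rho; case: cid.
have lin_rho : linear rho.
  by move=> a u v; apply: i_inj; rewrite linearP !irho linearP.
have rhoK v : rho (i v) = v.
  by apply: i_inj; rewrite irho rho0K //; apply/iP; exists v.
pose rhoL := mk_linear lin_rho.
exists P, (p \o i); split.
- move=> U V g f g_surj.
  have [h hE] := @projective_free T K _ _ g (f \o rhoL) g_surj.
  exists (h \o i) => v; rewrite -[LHS]/(g (h (i v))) hE.
  by rewrite -[LHS]/(f (rho (i v))) rhoK.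
- move=> x; apply: (t_nilpotent_nakayama (N := fun x => exists v, p (i v) = x)) x => //.
    split=> [|a _ _ [u <-] [v <-]]; first by exists 0; rewrite (linear0 i) (linear0 p).
    by exists (a *: u + v); rewrite (linearP i) (linearP p).
  move=> x; have [q Aq Jx] := Agen x; exists (p q) => //.
  by have [v <-] := (iP q).1 Aq; exists v.
- move=> L subL kL; apply: t_nilpotent_nakayama => // v.
  have [k [l [pk Ll ->]]] := kL v; exists l => //; rewrite addrK.
  have Jk : free_radical (i k).
    apply: Aind; first by apply/iP; exists k.
    by rewrite -[p _]/((p \o i) k) pk; exact: (submod0 (radical_mul_submodule M)).
  rewrite -(rhoK k) -[rho _]/(rhoL (i k)) linear_freeE.
  apply: (submod_sum (radical_mul_submodule P)).
  by move=> j _; exact: radical_mulZ.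
Qed.

End ProjectiveCovers.

Lemma projective_covers_exist (T : nzRingType) :
  t_nilpotent_radical T -> left_complemented T ->
  forall M : lmodType T, has_projective_cover M.
Proof.
move=> tnil cT M; have [p pE] := free_lift (fun k : cover_index M => k.1).
have [A [indA maxA]] := maximal_independent p.
exact: (independent_cover tnil indA (independent_generates tnil cT pE indA maxA)).
Qed.

(** * Semiartinian rings *)

(** Otherwise [j *: v] generates [V], so [v = r *: (j *: v)] for some [r], and a left inverse of
    [1 - r * j] gives [v = 0]. *)
Lemma simple_jacobson (S : nzRingType) (N : lmodType S) (V : N -> Prop) j v :
  simple_submodule V -> jacobson j -> V v -> j *: v = 0.
Proof.
move=> [subV _ minV] Jj Vv.
have [||jv|/(_ v Vv)[r vE]] := minV (fun y => exists r, y = r *: (j *: v)).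
- split=> [|a _ _ [r ->] [s ->]]; first by exists 0; rewrite scale0r.
  by exists (a * r + s); rewrite scalerDl scalerA.
- by move=> _ [r ->]; do 2!apply: (submodZ subV).
- by apply: jv; exists 1; rewrite scale1r.
have [u ur] := (jacobsonP j).1 Jj r.
have v0 : (1 - r * j) *: v = 0 by rewrite scalerBl scale1r -scalerA -vE subrr.
by rewrite -[v]scale1r -ur -scalerA v0 !scaler0.
Qed.

(** With [L] maximal among the left ideals missing [Q], the preimage of a simple submodule of
    [S / L] meets [Q] in some [q]; the radical kills that submodule, so the next product [j * q]
    falls in [L]. *)
Lemma semiartinian_t_nilpotent (S : nzRingType) :
  left_semiartinian_ring S -> t_nilpotent_radical S^c.
Proof.
move=> saS Q [q0 Qq0] Qstep; apply: contrapT => nQ0.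
pose P (L : S -> Prop) := left_ideal L /\ forall q, Q q -> ~ L q.
have [||L [[idL LQ] _ maxL]] := @zorn_above S P (fun x => x = 0).
- split=> [|q Qq q0']; last by apply: nQ0; rewrite -q0'.
  by split=> // [x y -> ->|r x ->]; rewrite ?addr0 ?mulr0.
- move=> F F0 FP Ftot; split; last by move=> q Qq [A /FP[_ AQ]]; exact: AQ.
  by apply: left_ideal_chain => // A /FP[].
have subL : submodule (L : S^o -> Prop).
  by case: idL => L0 LD LM; split=> // a x y Lx Ly; apply: LD => //; exact: LM.
have [N [f [f_surj kerf]]] := quotient_moduleP subL.
have [|V [subV [v Vv v0] minV]] := saS N.
  by exists (f q0); apply/eqP => /kerf; exact: LQ.
have idV : left_ideal (fun x : S => V (f x)).
  split=> [|x y Vx Vy|r x Vx]; first by rewrite linear0; exact: submod0 subV.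
    by rewrite linearD; exact: (submodD subV).
  by rewrite -[r * x]/(r *: (x : S^o)) linearZZ; exact: (submodZ subV).
have [q Qq Vq] : exists2 q, Q q & V (f q).
  apply: contrapT => nq; have [x fx] := f_surj v.
  apply: (negP v0); rewrite -fx; apply/eqP/kerf.
  apply: (maxL (fun x => V (f x))); last by rewrite fx.
    by split=> // q Qq Vq; apply: nq; exists q.
  by move=> y /kerf ->; exact: submod0 subV.
have [j /jacobson_conv Jj Qjq] := Qstep q Qq.
apply: (LQ _ Qjq); apply/kerf.
have := simple_jacobson (And3 subV (ex_intro2 _ _ v Vv v0) minV) Jj Vq.
by rewrite -linearZZ.
Qed.

(* If [m] is killed by [J] and [L] is a maximal left ideal containing its annihilator,
   a complement [L'] of [L] modulo [J] gives the simple submodule [L' m] (a copy of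
   [S / L]). *)
Lemma complemented_semiartinian (S : nzRingType) :
  left_complemented S -> t_nilpotent_radical S^c -> left_semiartinian_ring S.
Proof.
move=> cS tnil M [m0 m00].
have [m mn0 Jm] : exists2 m : M, m != 0 & forall j, jacobson j -> j *: m = 0.
  (* Otherwise every non-zero [a *: m0] has a non-zero multiple by a radical element, against
     T-nilpotence. *)
  apply: contrapT => nm; have [||] := tnil (fun a => (a : S) *: m0 <> 0).
  - by exists 1; rewrite scale1r; apply/eqP.
  - move=> a am0; apply: contrapT => nj; apply: nm; exists ((a : S) *: m0); first exact/eqP.
    move=> j Jj; apply: contrapT => jam; apply: nj; exists j; first exact/jacobson_conv.
    by rewrite -[a * j]/((j : S) * (a : S)) -scalerA.
  - by rewrite scale0r.
have [||L maxL annL] := @left_ideal_in_maximal S (fun r => r *: m = 0).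
- split=> [|x y xm ym|r x xm]; first exact: scale0r.
    by rewrite scalerDl xm ym addr0.
  by rewrite -scalerA xm scaler0.
- by exists 1; rewrite scale1r; apply/eqP.
have [idL prL _] := maxL; have [L' [idL' LL' LDL']] := cS L idL.
have [L'0 L'D L'M] := idL'; have [_ _ LM] := idL.
have nL c : c *: m <> 0 -> L' c -> ~ L c.
  by move=> cm L'c Lc; apply: cm; apply: Jm; exact: LL'.
exists (fun y => exists2 c, L' c & y = c *: m); split.
- split=> [|a _ _ [c L'c ->] [d L'd ->]]; first by exists 0; rewrite ?scale0r.
  by exists (a * c + d); [apply: L'D => //; exact: L'M|rewrite scalerDl scalerA].
- have [a [b [La L'b e1]]] := LDL' 1; exists (b *: m); first by exists b.
  apply/eqP => /annL Lb; apply: (left_ideal_proper1 idL prL).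
  by rewrite e1; case: (idL) => _ LD _; exact: LD.
- move=> W subW WV; have [W0|] := pselect (forall x, W x -> x = 0); first by left.
  move=> /existsNP[y /not_implyP[Wy y0]]; have [c L'c yE] := WV _ Wy; right=> _ [d L'd ->].
  rewrite yE in Wy y0.
  (* As [1 - r * c] is in [L], the element [d - d * r * c] is in both [L] and [L'], hence in the
     radical, which kills [m]. *)
  have [r Lrc] := maximal_left_ideal_bezout maxL (nL c y0 L'c).
  have drc : d *: m = (d * r) *: (c *: m).
    apply/eqP; rewrite -subr_eq0 scalerA -scalerBl; apply/eqP; apply: Jm; apply: LL'.
      by have := LM d _ Lrc; rewrite mulrBr mulr1 mulrA.
    by apply: left_idealB => //; exact: L'M.
  by rewrite drc; exact: (submodZ subW).
Qed.

(** * Right perfect rings and the equivalence *)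

Lemma right_perfectE (S : nzRingType) : right_perfect S <->
  left_complemented S /\ t_nilpotent_radical S^c.
Proof.
split=> [pS|[cS tnil]].
  split; last exact: projective_covers_t_nilpotent.
  exact/left_complemented_convE/projective_covers_left_complemented.
exact/projective_covers_exist/left_complemented_convE.
Qed.

Lemma right_perfect_semilocal (S : nzRingType) : right_perfect S -> semilocal S.
Proof. by move=> /right_perfectE[cS _]; exact/semilocalE. Qed.

Lemma right_perfect_semiartinian (S : nzRingType) :
  right_perfect S -> left_semiartinian_ring S.
Proof. by move=> /right_perfectE[]; exact: complemented_semiartinian. Qed.

Lemma semilocal_semiartinian_right_perfect (S : nzRingType) :
  semilocal S -> left_semiartinian_ring S -> right_perfect S.
Proof.
move=> /semilocalE cS saS; apply/right_perfectE; split=> //.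
exact: semiartinian_t_nilpotent.
Qed.

(** The radical of [S = R / P] is zero, so [M / P] has a true complement there. The product of
    [M / P] with it lies in both and vanishes, and primeness leaves only [M / P = 0]. *)
Lemma right_perfect_prime_maximal (R S : nzRingType) (f : {rmorphism R -> S})
    (P M : R -> Prop) : prime_ideal P -> is_factor_ring f P -> right_perfect S ->
  maximal_ideal M -> subp P M -> subp M P.
Proof.
move=> [idP _ primeP] [f_surj kerf] /right_perfectE[cS tnil] [idM prM _] PM.
have [_ _ JM] := jacobson_left_ideal S; have [_ _ _ JMr] := jacobson_ideal S.
have [M0 MD MMl MMr] := idM.
have J0 (y : S) : jacobson y -> y = 0.
  move=> Jy; apply: contrapT => y0; have [x xy] := f_surj y.
  (* By primeness, each non-zero [a] admits a non-zero product [y * f r * a], so such products would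
     never reach zero. *)
  have [||] // := tnil (fun a => a <> 0).
    by exists 1; apply/eqP; exact: oner_neq0.
  move=> a a0; have [b ba] := f_surj a.
  apply: contrapT => nj.
  have [r|Px|Pb] := primeP x b.
  - apply/kerf; rewrite !rmorphM xy ba; apply: contrapT => yra; apply: nj.
    by exists (y * f r) => //; apply/jacobson_conv; exact: JMr.
  - by apply: y0; rewrite -xy; apply/kerf.
  - by apply: a0; rewrite -ba; apply/kerf.
have idL : left_ideal (fun y => exists2 x, M x & f x = y).
  by apply: left_ideal_image => //; case: idM.
have [L' [[_ _ L'M] LL' LDL']] := cS _ idL.
have [_ [b [[m0 Mm0 <-] L'b e1]]] := LDL' 1; have [beta fbeta] := f_surj b.
move=> m Mm; have [r|//|Pbeta] := primeP m beta.
  apply/kerf; apply: J0; apply: LL'; first by exists (m * r * beta) => //; exact/MMr/MMr.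
  by rewrite rmorphM fbeta; exact: L'M.
(* If [beta] is in [P], then [b = 0] and [f m0 = 1], so [1 - m0] lies in [P] and [M] contains
   [1]. *)
case: (proper_ideal1 idM prM).
have -> : 1 = m0 + (1 - m0) by rewrite addrC subrK.
apply: MD => //; apply: PM; apply/kerf.
by rewrite rmorphB rmorph1 e1 addrAC subrr add0r -fbeta; apply/kerf.
Qed.

Theorem theorem3p7 (R : nzRingType) :
  let C0 := forall M : lmodType R, non_faithful M -> semiartinian M in
  (right_almost_perfect R <-> (h_local R /\ C0))
  /\ (C0 <-> forall M : lmodType R, non_faithful M -> essential_in (socle (M:=M)))
  /\ (C0 <-> forall M : lmodType R, nonzero_module M -> non_faithful M ->
                has_simple_submodule M)
  /\ (C0 <-> forall I : R -> Prop, two_sided_ideal I -> nonzero_pred I ->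
                forall (S : nzRingType) (f : {rmorphism R -> S}),
                  is_factor_ring f I -> left_semiartinian_ring S)
  /\ (C0 <-> forall L : R -> Prop, left_ideal L -> proper_pred L -> nonzero_core L ->
                forall (N : lmodType R) (f : {linear R^o -> N}),
                  is_factor_module f L -> has_simple_submodule N).
Proof.
move=> C0; have C02 := nonfaithful_semiartinian_simpleE R.
have C03 := iff_trans C02 (nonfaithful_simple_factor_ringE R).
split; last first.
  split; first exact: iff_trans C02 (nonfaithful_simple_socleE R).
  split; first exact: C02.
  split; first exact: C03.
  exact: iff_trans C02 (nonfaithful_simple_cyclicE R).
split=> [apR|[[slR _] /C03 saR] I idI I0 prI S f facf]; last first.
  apply: semilocal_semiartinian_right_perfect; first exact: slR facf.
  exact: saR facf.
split; last first.
  apply/C03 => I idI I0 S f facf; apply: right_perfect_semiartinian.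
  apply: (apR I idI I0 _ S f facf); exists 1 => /facf.2/eqP.
  by rewrite rmorph1 oner_eq0.
split=> [I idI I0 prI S f facf|P primeP P0 M1 M2 maxM1 maxM2 PM1 PM2 x].
  exact/right_perfect_semilocal/(apR I idI I0 prI S f facf).
(* [R / P] is right perfect, so both maximal ideals above [P] coincide with [P]. *)
have [idP prP _] := primeP; have [S [f facf]] := factor_ringP idP prP.
have pS : right_perfect S by exact: apR facf.
by split=> [/(right_perfect_prime_maximal primeP facf pS maxM1 PM1)/PM2|
            /(right_perfect_prime_maximal primeP facf pS maxM2 PM2)/PM1].
Qed.
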